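(* Let $\sigma(x)=x\Phi(x)$ be the GeLU activation. Then for all $\mu_1\in\mathbb R$ and all positive semidefinite $\begin{pmatrix}\nu_{11}&\nu_{12}\\ \nu_{12}&\nu_{22}\end{pmatrix}$, $$L_\sigma(\mu_1;\nu_{11},\nu_{22},\nu_{12})=\nu_{12}\,\frac{\mu_1}{(1+\nu_{11})^{3/2}}\,\phi\!\left(\frac{\mu_1}{\sqrt{1+\nu_{11}}}\right)+\nu_{12}\,\Phi\!\left(\frac{\mu_1}{\sqrt{1+\nu_{11}}}\right).$$
   Context: $\Phi$ and $\phi=\Phi'$ are the standard normal CDF and density. $L_\sigma(\mu_1;\nu_{11},\nu_{22},\nu_{12}):=\operatorname{Cov}(\sigma(X_1),X_2)$ where $(X_1,X_2)$ is jointly normal with covariance matrix $\begin{pmatrix}\nu_{11}&\nu_{12}\\ \nu_{12}&\nu_{22}\end{pmatrix}$, $\mathbb E X_1=\mu_1$, and $\mathbb E X_2$ arbitrary (the value does not depend on it). *)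

(* Defs.v *)
From HB Require Import structures.
From mathcomp Require Import all_boot all_order all_algebra.
From mathcomp Require Import all_classical all_reals all_analysis.

Set Implicit Arguments.
Unset Strict Implicit.
Unset Printing Implicit Defensive.

Import Order.TTheory GRing.Theory Num.Theory.
Import numFieldNormedType.Exports.

Local Open Scope classical_set_scope.
Local Open Scope ring_scope.

Definition Phi {R : realType} (x : R) : R := fine (normal_prob 0 1 `]-oo, x]).

Definition phi {R : realType} (x : R) : R := normal_pdf 0 1 x.

Definition gelu {R : realType} (x : R) : R := x * Phi x.

Definition sym_mx2 {R : realType} (a b c : R) : 'M[R]_2 :=
  @block_mx R 1 1 1 1 a%:M b%:M b%:M c%:M.

Definition psd {R : realType} (n : nat) (A : 'M[R]_n) : Prop :=
  A^T = A /\ forall x : 'cV[R]_n, 0 <= (x^T *m A *m x) 0 0.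

(* The case s = 0 is a separate Dirac clause because [normal_prob m 0] is, by
   convention of the library, the uniform distribution on [0, 1]. *)
Definition normal_law {R : realType} (mu : set R -> \bar R) : Prop :=
  (exists m : R, forall A : set R, measurable A -> mu A = \d_m A) \/
  (exists m s : R, 0 < s /\
    forall A : set R, measurable A -> mu A = normal_prob m s A).

(* Every linear combination is normal; this covers singular covariances. *)
Definition jointly_normal {R : realType} {d : measure_display}
    {T : measurableType d} (P : probability T R) (X1 X2 : {RV P >-> R}) : Prop :=
  forall a b : R, normal_law (pushforward P (fun w => a * X1 w + b * X2 w)).

Definition normal_pair {R : realType} {d : measure_display}
    {T : measurableType d} (P : probability T R) (X1 X2 : {RV P >-> R})
    (mu1 mu2 nu11 nu22 nu12 : R) : Prop :=
  jointly_normal X1 X2 /\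
  [/\ 'E_P[X1] = mu1%:E & 'E_P[X2] = mu2%:E]%E /\
  [/\ 'V_P[X1] = nu11%:E, 'V_P[X2] = nu22%:E
    & covariance P X1 X2 = nu12%:E]%E.

(* [is_L sigma mu1 nu11 nu22 nu12 l] says that
   L_sigma(mu1; nu11, nu22, nu12) is well defined and equal to l: whatever the
   mean mu2 of X2, jointly normal pairs with the prescribed moments exist, and
   all of them have Cov(sigma(X1), X2) = l. *)
Definition is_L {R : realType} (sigma : R -> R)
    (mu1 nu11 nu22 nu12 l : R) : Prop :=
  forall mu2 : R,
    (exists (d : measure_display) (T : measurableType d)
       (P : probability T R) (X1 X2 : {RV P >-> R}),
       normal_pair X1 X2 mu1 mu2 nu11 nu22 nu12) /\
    (forall (d : measure_display) (T : measurableType d)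
       (P : probability T R) (X1 X2 : {RV P >-> R}),
       normal_pair X1 X2 mu1 mu2 nu11 nu22 nu12 ->
       covariance P (sigma \o X1) X2 = l%:E).

(* Main.v *)
Require Import Defs.
From HB Require Import structures.
From mathcomp Require Import all_boot all_order all_algebra.
From mathcomp Require Import all_classical all_reals all_analysis.
From mathcomp Require Import measurable_realfun ring lra.

(* Let F be a primitive of gelu and put V = X2 - mu2.  As gelu is Lipschitz, Taylor's
   formula shows that b |-> E F(X1 + b V) is differentiable at 0 with derivative
   E[gelu(X1) V] = Cov(gelu(X1), X2).  On the other hand X1 + b V is normal with mean
   mu1 and variance nu11 + 2 b nu12 + b^2 nu22, so that only one-dimensional normal
   laws are involved.  With Z standard normal,
   F(x) = ((x^2 - 1) Phi x + x phi x) / 2 = E[max(0, x + Z)^2] / 2 - P(x + Z >= 0),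
   so for Y of law N(m, v) independent of Z, E F(Y) is the same expression with
   Y + Z of law N(m, 1 + v) in place of x + Z; it has a closed form, whose derivative
   in v is computed directly.  For existence, take affine functions of two independent
   standard normal variables, with coefficients from a Cholesky decomposition. *)

Set Implicit Arguments.
Unset Strict Implicit.
Unset Printing Implicit Defensive.

Import Order.TTheory GRing.Theory Num.Theory.
Import numFieldNormedType.Exports.

Local Open Scope classical_set_scope.
Local Open Scope ring_scope.

(** * Integration against a normal law through its density *)

Section normal_prob_integral.
Context {R : realType}.
Local Open Scope ereal_scope.
Local Notation mu := (@lebesgue_measure R).
Implicit Types (f : measurableTypeR R -> \bar R) (m s a b : R).

Lemma integral_normal_prob_indic m s (A : set (measurableTypeR R)) : measurable A ->
  \int[normal_prob m s]_x (\1_A x)%:E =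
  \int[mu]_x ((\1_A x)%:E * (normal_pdf m s x)%:E).
Proof.
move=> mA; rewrite integral_indic// setIT.
transitivity (\int[mu]_(x in A) (normal_pdf m s x)%:E); first by [].
rewrite integral_mkcond; apply: eq_integral => x _; rewrite patchE indicE.
by case: (x \in A); rewrite ?mul1e ?mul0e.
Qed.

Lemma measurable_EFin_normal_pdf m s :
  measurable_fun [set: measurableTypeR R] (fun x => (normal_pdf m s x)%:E).
Proof. by apply: measurableT_comp => //; exact: measurable_normal_pdf. Qed.

Import HBNNSimple.

Lemma integral_normal_prob_nnsfun m s (f : {nnsfun measurableTypeR R >-> R}) :
  \int[normal_prob m s]_x (f x)%:E =
  \int[mu]_x ((f x)%:E * (normal_pdf m s x)%:E).
Proof.
have mpdf := measurable_EFin_normal_pdf m s.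
under [LHS]eq_integral do rewrite fimfunE -fsumEFin//.
rewrite [LHS]ge0_integral_fsum//; last 2 first.
  - by move=> r; exact/measurable_EFinP/measurableT_comp.
  - by move=> n x _; rewrite EFinM nnfun_muleindic_ge0.
under [RHS]eq_integral.
  move=> x xD; rewrite fimfunE -fsumEFin// ge0_mule_fsuml; last first.
    by move=> r; rewrite EFinM nnfun_muleindic_ge0.
  over.
rewrite [RHS]ge0_integral_fsum//; last 2 first.
  - move=> r; apply: emeasurable_funM => //.
    by apply/measurable_EFinP; apply/measurableT_comp => //.
  - move=> n x _; apply: mule_ge0; last by rewrite lee_fin normal_pdf_ge0.
    by rewrite EFinM nnfun_muleindic_ge0.
apply: eq_fsbigr => r _.
have [r0|r0] := leP 0%R r; last first.
  rewrite preimage_nnfun0//; under eq_integral do rewrite indic0 mulr0.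
  rewrite integral0; under eq_integral do rewrite indic0 mulr0 mul0e.
  by rewrite integral0.
under eq_integral do rewrite EFinM.
under [RHS]eq_integral do rewrite EFinM -muleA.
rewrite !ge0_integralZl//.
- by rewrite integral_normal_prob_indic.
- by apply: emeasurable_funM => //; exact/measurable_EFinP.
- by move=> x _; rewrite mule_ge0// lee_fin ?normal_pdf_ge0.
- exact/measurable_EFinP.
Qed.

(** The usual three stages: indicators, where it is the definition of [normal_prob]; simple
    functions by linearity; increasing limits by monotone convergence. *)
Lemma ge0_integral_normal_prob m s f :
  measurable_fun setT f -> (forall x, 0 <= f x) ->
  \int[normal_prob m s]_x f x = \int[mu]_x (f x * (normal_pdf m s x)%:E).
Proof.
move=> mf f0.
have mpdf := measurable_EFin_normal_pdf m s.
pose f_ := nnsfun_approx measurableT mf.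
transitivity (lim (\int[normal_prob m s]_x (f_ n x)%:E @[n --> \oo])).
  rewrite -monotone_convergence//=.
  - apply: eq_integral => ? /[!inE] xD; apply/esym/cvg_lim => //=.
    exact: cvg_nnsfun_approx.
  - by move=> n; exact/measurable_EFinP/measurable_funTS.
  - by move=> n ? _; rewrite lee_fin.
  - by move=> ? _ ? ? mn; rewrite lee_fin; exact/lefP/nd_nnsfun_approx.
transitivity (lim (\int[mu]_x ((f_ n x)%:E * (normal_pdf m s x)%:E) @[n --> \oo])).
  by apply: congr_lim; apply/funext => n /=; exact: integral_normal_prob_nnsfun.
rewrite -monotone_convergence//=.
- apply: eq_integral => x _; apply/cvg_lim => //=.
  by apply: cvgeZr => //; exact: cvg_nnsfun_approx.
- by move=> n; apply: emeasurable_funM => //; exact/measurable_EFinP.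
- by move=> n x _; rewrite mule_ge0 ?lee_fin// normal_pdf_ge0.
- move=> x _ i j ij; rewrite lee_wpmul2r ?lee_fin ?normal_pdf_ge0//.
  exact/lefP/nd_nnsfun_approx.
Qed.

End normal_prob_integral.

(** * Affine substitutions in Lebesgue and normal integrals *)

Section affine_change_of_variable.
Context {R : realType}.
Local Open Scope ereal_scope.
Local Notation mu := (@lebesgue_measure R).
Implicit Types (f : measurableTypeR R -> \bar R) (m s a b : R).

Definition affine_map m s (x : measurableTypeR R) : measurableTypeR R := (m + s * x)%R.

Lemma measurable_affine_map m s : measurable_fun setT (affine_map m s).
Proof. by apply: measurable_funD => //; exact: measurable_funM. Qed.

HB.instance Definition _ m s := isMeasurableFun.Build _ _ _ _
  (affine_map m s) (measurable_affine_map m s).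

(** Lebesgue measure is determined by its values on half-open intervals, so only their preimages are
    measured; the endpoints trade places when [s < 0]. *)
Lemma lebesgue_measure_affine m s (A : set (measurableTypeR R)) :
  s != 0%R -> measurable A ->
  (`|s|%R)%:E * pushforward mu (affine_map m s) A = mu A.
Proof.
pose nu := measure_function_pushforward__canonical__measure_function_Measure
  mu (measurable_affine_map m s).
pose k := NngNum (normr_ge0 s).
move=> s0 mA; transitivity (mscale k nu A); first by [].
apply: esym; apply: (@lebesgue_measure_unique R (mscale k nu)) => //.
move=> _ [[a b]] _ <-.
transitivity ((`|s|%R)%:E * mu (affine_map m s @^-1` `]a, b]%classic)); last by [].
have [sp|sn] : (0 < s)%R \/ (s < 0)%R by apply/orP; rewrite orbC -neq_lt.
- rewrite (_ : affine_map m s @^-1` _ =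
      `]((a - m) / s)%R, ((b - m) / s)%R]%classic); last first.
    apply/seteqP; split => x; rewrite /affine_map/= !in_itv/= => /andP[h1 h2].
      by rewrite ltr_pdivrMr// ler_pdivlMr// !(mulrC x) lerBrDl ltrBlDl h1 h2.
    by move: h1 h2; rewrite ltr_pdivrMr// ler_pdivlMr// !(mulrC x) lerBrDl ltrBlDl => -> ->.
  rewrite !lebesgue_measure_itv/= !lte_fin ltr_pM2r ?invr_gt0// ltrD2r.
  case: ifPn => _; rewrite ?mule0// gtr0_norm// -!EFinB -EFinM; congr EFin.
  by field; rewrite gt_eqF.
- rewrite (_ : affine_map m s @^-1` _ =
      `[((b - m) / s)%R, ((a - m) / s)%R[%classic); last first.
    apply/seteqP; split => x; rewrite /affine_map/= !in_itv/= => /andP[h1 h2].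
      by rewrite ler_ndivrMr// ltr_ndivlMr// !(mulrC x) lerBrDl ltrBlDl h1 h2.
    by move: h1 h2; rewrite ler_ndivrMr// ltr_ndivlMr// !(mulrC x) lerBrDl ltrBlDl => -> ->.
  rewrite !lebesgue_measure_itv/= !lte_fin ltr_nM2r ?invr_lt0// ltrD2r.
  case: ifPn => _; rewrite ?mule0// ltr0_norm// -!EFinB -EFinM; congr EFin.
  by field; rewrite lt_eqF.
Qed.

Lemma ge0_integral_affine m s f : s != 0%R ->
  measurable_fun setT f -> (forall x, 0 <= f x) ->
  \int[mu]_x f x = (`|s|%R)%:E * \int[mu]_x f (m + s * x)%R.
Proof.
move=> s0 mf f0.
pose nu := measure_function_pushforward__canonical__measure_function_Measure
  mu (measurable_affine_map m s).
pose k := NngNum (normr_ge0 s).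
transitivity (\int[mscale k nu]_x f x).
  by apply: eq_measure_integral => A mA _; exact/esym/lebesgue_measure_affine.
by rewrite ge0_integral_mscale//= ge0_integral_pushforward.
Qed.

(** The Jacobian [|s|] of the substitution cancels the same factor in the normal peak. *)
Lemma normal_pdf_affine m s x : s != 0%R ->
  (`|s| * normal_pdf m s (m + s * x))%R = normal_pdf 0 1 x.
Proof.
move=> s0; rewrite !normal_pdfE ?oner_eq0// /normal_peak /normal_fun.
rewrite expr1n -mulrnAr sqrtrM ?sqr_ge0// sqrtr_sqr mul1r invfM !mulrA.
rewrite mulfV ?normr_eq0// mul1r subr0 addrC addKr; congr (_ * expR _)%R.
by rewrite exprMn; field.
Qed.

Lemma ge0_integral_normal_affine m s f : s != 0%R ->
  measurable_fun setT f -> (forall x, 0 <= f x) ->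
  \int[normal_prob m s]_x f x = \int[normal_prob 0 1]_x f (m + s * x)%R.
Proof.
move=> s0 mf f0.
have mpdf := measurable_EFin_normal_pdf.
have pdf0 m' s' x : 0 <= (normal_pdf m' s' x)%:E by rewrite lee_fin normal_pdf_ge0.
have mfa : measurable_fun [set: measurableTypeR R] (fun x => f (m + s * x)%R).
  by apply: (measurableT_comp mf); exact: (measurable_affine_map m s).
have mpdfa : measurable_fun [set: measurableTypeR R]
    (fun x => (normal_pdf m s (m + s * x))%:E).
  exact: (measurableT_comp (mpdf R m s) (measurable_affine_map m s)).
rewrite (ge0_integral_normal_prob m s mf f0).
rewrite (ge0_integral_normal_prob 0 1 mfa) => [|x]; last exact: f0.
rewrite (ge0_integral_affine m s0); first last.
- by move=> x; rewrite mule_ge0.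
- exact: emeasurable_funM.
rewrite -ge0_integralZl//; first last.
- by move=> x _; rewrite mule_ge0.
- exact: emeasurable_funM.
by apply: eq_integral => x _; rewrite muleCA -EFinM normal_pdf_affine.
Qed.

Lemma ge0_integral_normal_opp f :
  measurable_fun setT f -> (forall x, 0 <= f x) ->
  \int[normal_prob 0 1]_x f x = \int[normal_prob 0 1]_x f (- x)%R.
Proof.
move=> mf f0; have n10 : (- 1 != 0 :> R)%R by rewrite oppr_eq0 oner_eq0.
(* Reflection is the affine map with [s = -1]. For nonzero [s] the density depends on [s] only
   through its square, so [normal_prob 0 (-1)] and [normal_prob 0 1] agree. *)
transitivity (\int[normal_prob 0 (-1)]_x f x).
  apply: eq_measure_integral => A mA _ /=.
  rewrite /normal_prob /normal_pdf (negbTE n10) oner_eq0.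
  by rewrite /normal_peak /normal_fun sqrrN.
rewrite ge0_integral_normal_affine//.
by apply: eq_integral => x _; rewrite add0r mulN1r.
Qed.
End affine_change_of_variable.

(** * Sums of two independent centered normal variables *)

Section normal_convolution.
Context {R : realType}.
Local Open Scope ereal_scope.
Local Notation mu := (@lebesgue_measure R).
Local Notation mR := (measurableTypeR R).
Implicit Types (f : mR -> \bar R) (m s a b : R).

(* Bayes' formula: [x] standard normal and [y] given [x] of law N(a x, b^2), versus
   [y] of law N(0, r^2) and [x] given [y] normal. *)
Lemma normal_pdf_bayes a b r x y : b != 0%R -> (0 < r)%R ->
    (r ^+ 2 = a ^+ 2 + b ^+ 2)%R ->
  (normal_pdf (a * x) b y * normal_pdf 0 1 x =
   normal_pdf 0 r y * normal_pdf (a * y / r ^+ 2) (b / r) x)%R.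
Proof.
move=> b0 r0 rE; have rn0 : (r != 0)%R by rewrite gt_eqF.
have br0 : (b / r != 0)%R by rewrite mulf_neq0 ?invr_eq0.
rewrite !normal_pdfE ?oner_eq0// /normal_peak /normal_fun.
(* Each side becomes one inverse square root times one exponential: the variances multiply to the
   same product, and the exponents agree by completing the square in [x]. *)
rewrite !(mulrACA _ (expR _)) -!expRD -!invfM -!sqrtrM; last 2 first.
- by rewrite mulrn_wge0// mulr_ge0 ?sqr_ge0 ?pi_ge0.
- by rewrite mulrn_wge0// mulr_ge0 ?sqr_ge0 ?pi_ge0.
congr ((Num.sqrt _)^-1 * expR _)%R.
  by field.
have r2 : (a ^+ 2 + b ^+ 2 != 0)%R by rewrite -rE sqrf_eq0.
by rewrite expr_div_n rE; field; rewrite r2.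
Qed.

(** Given [x], the value [a x + b y] has density [normal_pdf (a x) b]. After Tonelli, Bayes' formula
    leaves a probability density in [x], which integrates to 1. *)
Lemma ge0_integral_normal_normal a b f :
  measurable_fun setT f -> (forall x, 0 <= f x) ->
  \int[normal_prob 0 1]_x \int[normal_prob 0 1]_y f (a * x + b * y)%R =
  \int[normal_prob 0 1]_z f (Num.sqrt (a ^+ 2 + b ^+ 2) * z)%R.
Proof.
move=> mf f0.
(* For [b = 0] there is no conditional density; the root is then [|a|], and symmetry of the law
   covers negative [a]. *)
have [->|b0] := eqVneq b 0%R.
  transitivity (\int[normal_prob 0 1]_x f (a * x)%R).
    apply: eq_integral => x _.
    under eq_integral do rewrite mul0r addr0.
    rewrite integral_cst// -[RHS]mule1; congr (_ * _).
    exact: probability_setT.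
  rewrite expr0n addr0 sqrtr_sqr.
  have mfa c : measurable_fun [set: mR] (fun x => f (c * x)%R).
    by apply: (measurableT_comp mf); exact: measurable_funM.
  have [a0|a0] := leP 0%R a; first by rewrite ger0_norm.
  rewrite ltr0_norm// ge0_integral_normal_opp//.
  by under eq_integral do rewrite mulrN -mulNr.
set r := Num.sqrt _.
have r0 : (0 < r)%R by rewrite sqrtr_gt0 ltr_wpDl ?sqr_ge0 ?exprn_even_gt0.
have rE : (r ^+ 2 = a ^+ 2 + b ^+ 2)%R.
  by rewrite sqr_sqrtr// addr_ge0 ?sqr_ge0.
have pdf0 m s x : 0 <= (normal_pdf m s x)%:E by rewrite lee_fin normal_pdf_ge0.
have mpdf2 : measurable_fun [set: mR * mR]
    (fun z => (normal_pdf (a * z.1) b z.2)%:E).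
  apply/measurable_EFinP.
  (* A centered density evaluated at a difference is visibly measurable jointly in the mean and the
     point. *)
  rewrite (_ : (fun z => _) =
      normal_pdf 0 b \o (fun z : mR * mR => z.2 - a * z.1)%R); last first.
    apply/funext => z /=.
    by rewrite !normal_pdfE// /normal_fun subr0.
  apply: measurableT_comp; first exact: measurable_normal_pdf.
  by apply: measurable_funB => //; exact: measurable_funM.
pose g (z : mR * mR) := f z.2 * (normal_pdf (a * z.1) b z.2)%:E.
have mg : measurable_fun setT g.
  by apply: emeasurable_funM => //; exact: measurableT_comp.
have g0 z : 0 <= g z by rewrite mule_ge0.
transitivity (\int[normal_prob 0 1]_x \int[mu]_y g (x, y)).
  apply: eq_integral => x _.
  rewrite -(ge0_integral_normal_affine (a * x) b0 mf f0).
  exact: (ge0_integral_normal_prob (a * x) b mf f0).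
have mG := measurable_fun_fubini_tonelli_F (m2 := mu) g mg g0.
rewrite (ge0_integral_normal_prob 0 1 mG); last first.
  by move=> x; exact: integral_ge0.
pose h (z : mR * mR) := g z * (normal_pdf 0 1 z.1)%:E.
have mpdf := @measurable_EFin_normal_pdf R.
have mh : measurable_fun setT h.
  apply: emeasurable_funM => //.
  exact: (measurableT_comp (mpdf 0 1)%R measurable_fst).
have h0 z : 0 <= h z by rewrite mule_ge0.
transitivity (\int[mu]_x \int[mu]_y h (x, y)).
  apply: eq_integral => x _.
  rewrite /fubini_F -ge0_integralZr//.
  exact: (measurableT_comp mg (measurable_pair1 _)).
rewrite (fubini_tonelli h mh h0).
transitivity (\int[mu]_y (f y * (normal_pdf 0 r y)%:E)).
  apply: eq_integral => y _.
  transitivity (\int[mu]_x (f y * (normal_pdf 0 r y)%:E *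
      (normal_pdf (a * y / r ^+ 2) (b / r) x)%:E)).
    apply: eq_integral => x _.
    by rewrite /h /g/= -!muleA -!EFinM (@normal_pdf_bayes a b r).
  rewrite ge0_integralZl//; first by rewrite integral_normal_pdf mule1.
  by rewrite mule_ge0.
rewrite -(ge0_integral_normal_prob 0 r mf f0).
rewrite (ge0_integral_normal_affine 0 _ mf f0) ?gt_eqF//.
by apply: eq_integral => z _; rewrite add0r.
Qed.
End normal_convolution.

(** * Derivatives, bounds and limits of [phi] and [Phi] *)

Section standard_normal_calculus.
Context {R : realType}.
Local Notation mu := (@lebesgue_measure R).
Local Notation mR := (measurableTypeR R).
Implicit Types x y : R.

Lemma phiE x : phi x = normal_peak 1 * expR (- (x ^+ 2 / 2)).
Proof.
rewrite /phi normal_pdfE ?oner_eq0// /normal_fun subr0 expr1n.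
by rewrite mulNr.
Qed.

Lemma phi_ge0 x : 0 <= phi x. Proof. exact: normal_pdf_ge0. Qed.

Lemma phiN x : phi (- x) = phi x. Proof. by rewrite !phiE sqrrN. Qed.

Global Instance is_derive_phi x : is_derive x 1 phi (- (x * phi x)).
Proof.
have -> : phi = (fun y : R => normal_peak 1 * expR (- (y ^+ 2 / 2))).
  by apply/funext => y; exact: phiE.
apply: is_derive_eq.
by rewrite /GRing.scale/= ; field.
Qed.

Lemma continuous_phi : continuous (@phi R).
Proof. by apply: continuous_normal_pdf; exact: oner_neq0. Qed.

Lemma EFin_Phi x : (Phi x)%:E = normal_prob 0 1 `]-oo, x].
Proof. by rewrite /Phi fineK// fin_num_measure. Qed.

Lemma Phi_ge0 x : 0 <= Phi x.
Proof. exact/fine_ge0/measure_ge0. Qed.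

Lemma Phi_le1 x : Phi x <= 1.
Proof. by rewrite -lee_fin EFin_Phi; exact: probability_le1. Qed.

Global Instance is_derive_Phi x : is_derive x 1 Phi (phi x).
Proof.
(* The fundamental theorem of calculus is applied inside an interval; [x + 1] is an arbitrary right
   end beyond [x]. *)
have x1 : (x < x + 1)%R by rewrite ltrDl.
have int : mu.-integrable [set` Interval -oo%O (BRight (x + 1))] (EFin \o @phi R).
  by apply: (integrableS _ _ (@subsetT _ _)) => //; exact: integrable_normal_pdf.
have [dF FE] := @continuous_FTC1 R phi -oo%O x (x + 1) x1 int (ltNyr _) (@continuous_phi x).
apply: DeriveDef; first exact: dF.
by rewrite -FE derive1E.
Qed.

Lemma continuous_Phi : continuous (@Phi R).
Proof. by move=> x; apply/differentiable_continuous/derivable1_diffP; apply: ex_derive. Qed.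

Lemma measurable_Phi : measurable_fun [set: mR] (@Phi R).
Proof. by apply: continuous_measurable_fun; exact: continuous_Phi. Qed.

Lemma cvg_Phi_pinfty : Phi x @[x --> +oo] --> (1 : R).
Proof.
(* [Phi] is the distribution function of the identity, viewed as a random variable under the
   standard normal law. *)
pose idmix := isMeasurableFun.Build _ _ mR R idfun (@measurable_id _ _ setT).
pose X : {mfun mR >-> R} := HB.pack (idfun : mR -> R) idmix.
have /fine_cvg := @cvg_cdfy1 _ _ _ (normal_prob 0 1) X.
exact.
Qed.

(** Rests on [|x| <= 1 + x^2 / 2 <= exp (x^2 / 2)]. It serves to bound the derivative of [gelu]. *)
Lemma norm_x_phi_le x : `|x * phi x| <= normal_peak 1.
Proof.
rewrite normrM (ger0_norm (phi_ge0 x)) phiE mulrCA ger_pMr ?normal_peak_gt0 ?oner_neq0//.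
rewrite expRN ler_pdivrMr ?expR_gt0// mul1r.
rewrite (le_trans _ (expR_ge1Dx _))//.
rewrite -real_normK ?num_real//.
set y := `|x|; have := sqr_ge0 (y - 1); rewrite sqrrB1.
lra.
Qed.

Lemma cvg_x_phi_pinfty : x * phi x @[x --> +oo] --> (0 : R).
Proof.
apply: (@squeeze_cvgr _ _ _ _ (cst 0) (fun x => 2 * normal_peak 1 * x^-1)).
- near=> x; have x0 : 0 < x by near: x; exact: nbhs_pinfty_gt.
  have key : x / expR (x ^+ 2 / 2) <= 2 * x^-1.
    rewrite ler_pdivrMr ?expR_gt0// mulrAC ler_pdivlMr//.
    have := expR_ge1Dx (x ^+ 2 / 2); rewrite expr2; lra.
  rewrite mulr_ge0 ?phi_ge0 ?(ltW x0)//= phiE expRN.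
  rewrite (_ : 2 * normal_peak 1 * x^-1 = normal_peak 1 * (2 * x^-1)); last by ring.
  by rewrite mulrCA ler_wpM2l ?normal_peak_ge0.
- exact: cvg_cst.
- rewrite -[X in _ --> X](mulr0 (2 * normal_peak 1)); apply: cvgM; first exact: cvg_cst.
  apply/gtr0_cvgV0; last exact: cvg_id.
  exact: nbhs_pinfty_gt.
Unshelve. all: by end_near. Qed.

Lemma cvg_phi_pinfty : phi x @[x --> +oo] --> (0 : R).
Proof.
apply: (@squeeze_cvgr _ _ _ _ (cst 0) (fun x => x * phi x)).
- near=> x; have x1 : 1 <= x by near: x; exact: nbhs_pinfty_ge.
  by rewrite phi_ge0 ler_peMl ?phi_ge0.
- exact: cvg_cst.
- exact: cvg_x_phi_pinfty.
Unshelve. all: by end_near. Qed.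
End standard_normal_calculus.

(** * Gaussian averages of the half-line indicator and of squares *)

Section standard_normal_integrals.
Context {R : realType}.
Local Notation mu := (@lebesgue_measure R).
Local Notation mR := (measurableTypeR R).
Local Notation N01 := (normal_prob (0 : R) 1).
Implicit Types x y : R.

Lemma normal_prob_itvcy x : N01 `[x, +oo[ = (1 - Phi x)%:E.
Proof.
transitivity (\int[mu]_(t in `[x, +oo[) (phi t)%:E)%E; first by [].
rewrite (@ge0_continuous_FTC2y R phi Phi x 1) ?EFinB//.
- by move=> t _; exact: phi_ge0.
- exact/continuous_subspaceT/continuous_phi.
- exact: cvg_Phi_pinfty.
- by apply: cvg_at_right_filter; exact: continuous_Phi.
- by move=> t _; rewrite derive1E derive_val.
Qed.

Lemma PhiN x : Phi (- x) = 1 - Phi x.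
Proof.
apply: EFin_inj; rewrite -normal_prob_itvcy EFin_Phi.
transitivity (\int[N01]_z (\1_(`]-oo, - x]%classic : set mR) z)%:E)%E.
  by rewrite integral_indic// setIT.
transitivity (\int[N01]_z (\1_(`[x, +oo[%classic : set mR) z)%:E)%E; last first.
  by rewrite integral_indic// setIT.
rewrite ge0_integral_normal_opp//; last first.
  by apply/measurable_EFinP; exact: measurable_indic.
apply: eq_integral => z _; congr EFin; rewrite !indicE; congr (nat_of_bool _)%:R.
by apply/idP/idP; rewrite !inE/= !in_itv/= andbT lerN2.
Qed.

Definition nonneg_indic (y : R) : R := (0 <= y)%R%:R.

Definition pos_part_sqr (y : R) : R := Num.max 0 y ^+ 2.

(** Closed form of the mean of [pos_part_sqr (x + Z)] with [Z] standard normal. *)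
Definition pos_sqr_mean x : R := (x ^+ 2 + 1) * Phi x + x * phi x.

Lemma measurable_nonneg_indic : measurable_fun [set: mR] nonneg_indic.
Proof.
rewrite (_ : nonneg_indic = \1_(`[0, +oo[%classic : set mR)).
  exact: measurable_indic.
apply/funext => y; rewrite indicE /nonneg_indic; congr (nat_of_bool _)%:R.
by apply/idP/idP; rewrite inE/= in_itv/= andbT.
Qed.

Lemma measurable_pos_part_sqr : measurable_fun [set: mR] pos_part_sqr.
Proof. by apply: measurable_funX; exact: measurable_maxr. Qed.

Lemma integral_nonneg_indic x :
  (\int[N01]_z (nonneg_indic (x + z))%:E = (Phi x)%:E)%E.
Proof.
transitivity (\int[N01]_z (\1_(`[- x, +oo[%classic : set mR) z)%:E)%E.
  apply: eq_integral => z _; congr EFin.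
  rewrite indicE /nonneg_indic; congr (nat_of_bool _)%:R.
  by apply/idP/idP; rewrite inE/= in_itv/= andbT => h; lra.
rewrite integral_indic// setIT; transitivity (1 - Phi (- x))%:E.
  exact: normal_prob_itvcy.
by rewrite PhiN opprB addrC subrK.
Qed.

Lemma integral_pos_part_sqr x :
  (\int[N01]_z (pos_part_sqr (x + z))%:E = (pos_sqr_mean x)%:E)%E.
Proof.
have mf : measurable_fun [set: mR] (fun z => (pos_part_sqr (x + z))%:E).
  apply/measurable_EFinP; apply: (measurableT_comp measurable_pos_part_sqr).
  exact: measurable_funD.
rewrite (ge0_integral_normal_prob 0 1 mf); last first.
  by move=> z; rewrite lee_fin sqr_ge0.
(* Expand the square: [z phi z] has primitive [- phi z], and [z^2 phi z] has primitive
   [Phi z - z phi z]. At infinity only the [Phi] term survives. *)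
pose G z := (x ^+ 2 + 1) * Phi z - (2 * x * phi z + z * phi z).
have dG (z : R) : is_derive z 1 G ((x + z) ^+ 2 * phi z).
  by apply: is_derive_eq; rewrite /GRing.scale/=; ring.
transitivity (\int[mu]_(z in `[(- x)%R, +oo[) ((x + z) ^+ 2 * phi z)%:E)%E.
  rewrite [RHS]integral_mkcond; apply: eq_integral => z _.
  rewrite patchE; case: ifPn => [|zx].
    rewrite inE/= in_itv/= andbT => xz.
    by rewrite -EFinM /pos_part_sqr max_r//; lra.
  rewrite /pos_part_sqr max_l ?expr0n ?mul0e//.
  move: zx; rewrite notin_setE/= in_itv/= andbT => /negP.
  by rewrite -ltNge => zx; lra.
rewrite (@ge0_continuous_FTC2y R _ G (- x) (x ^+ 2 + 1)).
- rewrite -EFinB; congr EFin; rewrite /G /pos_sqr_mean PhiN phiN; ring.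
- by move=> t _; rewrite mulr_ge0 ?sqr_ge0 ?phi_ge0.
- apply: continuous_subspaceT => z; apply: cvgM; last exact: continuous_phi.
  by apply: cvgM; apply: cvgD; [exact: cvg_cst|exact: cvg_id|exact: cvg_cst|exact: cvg_id].
- rewrite -[X in _ --> X]subr0 -[X in _ --> X - _]mulr1.
  apply: cvgB; first by apply: cvgMr; exact: cvg_Phi_pinfty.
  rewrite -[X in _ --> X](addr0) -[X in _ --> X + _](mulr0 (2 * x)).
  apply: cvgD; last exact: cvg_x_phi_pinfty.
  by apply: cvgMr; exact: cvg_phi_pinfty.
- by move=> t _; exact: ex_derive.
- apply: cvg_at_right_filter.
  by apply/differentiable_continuous/derivable1_diffP; apply: ex_derive.
- by move=> t _; rewrite derive1E derive_val.
Qed.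

(** A square is the sum of the squares of the positive and negative parts; by symmetry of the law
    both have means given by [pos_sqr_mean], at [x] and at [- x]. *)
Lemma integral_sqr_normal x : (\int[N01]_z ((x + z) ^+ 2)%:E = (x ^+ 2 + 1)%:E)%E.
Proof.
have mf y : measurable_fun [set: mR] (fun z => (pos_part_sqr (y + z))%:E).
  apply/measurable_EFinP; apply: (measurableT_comp measurable_pos_part_sqr).
  exact: measurable_funD.
have f0 y z : (0 <= (pos_part_sqr (y + z))%:E)%E by rewrite lee_fin sqr_ge0.
have mfo : measurable_fun [set: mR] (fun z => (pos_part_sqr (- x - z))%:E).
  apply/measurable_EFinP; apply: (measurableT_comp measurable_pos_part_sqr).
  exact: measurable_funB.
transitivity (\int[N01]_z ((pos_part_sqr (x + z))%:E +
    (pos_part_sqr (- x - z))%:E))%E.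
  apply: eq_integral => z _; rewrite -EFinD -opprD /pos_part_sqr; congr EFin.
  by have [xz|xz] := leP 0 (x + z); [rewrite max_l|rewrite max_r];
    rewrite ?oppr_le0 ?oppr_ge0 ?(ltW xz)// expr0n ?addr0 ?add0r ?sqrrN.
rewrite ge0_integralD//.
rewrite -(@ge0_integral_normal_opp _ (fun z => (pos_part_sqr (- x + z))%:E))//.
rewrite !integral_pos_part_sqr -EFinD; congr EFin.
by rewrite /pos_sqr_mean PhiN phiN; ring.
Qed.

End standard_normal_integrals.

(** * Random variables with a possibly degenerate normal law, and their moments *)

Section normal_law_of_random_variable.
Context {d : measure_display} {T : measurableType d} {R : realType}.
Local Notation mR := (measurableTypeR R).
Local Notation N01 := (normal_prob (0 : R) 1).
Variable P : probability T R.
Implicit Types (Y : T -> R) (m s : R).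

(* [Y] has the law of [m + s * Z] with [Z] standard normal; [s = 0] is allowed. *)
Definition affine_normal Y m s :=
  forall f : mR -> \bar R, measurable_fun setT f -> (forall x, 0 <= f x)%E ->
  (\int[P]_w f (Y w) = \int[N01]_z f (m + s * z)%R)%E.

(** The Dirac clause of [normal_law] becomes [s = 0], so both kinds of law share one integration
    formula. *)
Lemma normal_law_affine_normal Y : measurable_fun setT Y ->
  normal_law (pushforward P Y) -> exists m s, 0 <= s /\ affine_normal Y m s.
Proof.
move=> mY; pose nu := measure_function_pushforward__canonical__measure_function_Measure
  P (f := (Y : T -> mR)) mY.
have nuE f : measurable_fun [set: mR] f -> (forall x, 0 <= f x)%E ->
    (\int[P]_w f (Y w) = \int[nu]_x f x)%E.
  by move=> mf f0; rewrite ge0_integral_pushforward.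
case=> [[m hm]|[m [s [s0 hs]]]].
  exists m, 0; split=> // f mf f0; rewrite nuE//.
  transitivity (\int[\d_(m : mR)]_x f x)%E.
    by apply: eq_measure_integral => A mA _; exact: hm.
  rewrite integral_dirac// diracT mul1e.
  under eq_integral do rewrite mul0r addr0.
  by rewrite integral_cst// -[LHS]mule1; congr (_ * _)%E; exact/esym/probability_setT.
exists m, s; split=> [|f mf f0]; first exact: ltW.
rewrite nuE// -(ge0_integral_normal_affine m _ mf f0) ?gt_eqF//.
by apply: eq_measure_integral => A mA _; exact: hs.
Qed.

(** Test the integration formula on indicators. This yields joint normality of the pairs constructed
    for existence. *)
Lemma affine_normal_law Y m s : 0 <= s -> measurable_fun setT Y ->
  affine_normal Y m s -> normal_law (pushforward P Y).
Proof.
move=> s0 mY YN.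
have YA (A : set mR) : measurable A ->
    (pushforward P Y A = \int[N01]_z (\1_A (m + s * z))%:E)%E.
  move=> mA; rewrite -(YN (fun x => (\1_A x)%:E)); first last.
  - by move=> x; rewrite lee_fin.
  - by apply/measurable_EFinP; exact: measurable_indic.
  rewrite (_ : (fun w => _) = (fun w => (\1_(Y @^-1` A) w)%:E))//.
  rewrite integral_indic ?setIT//.
  by rewrite -[X in measurable X]setTI; exact: mY.
have [s00|sn0] := eqVneq s 0.
  left; exists m => A mA; rewrite YA// s00.
  under eq_integral do rewrite mul0r addr0.
  rewrite integral_cst// -[RHS]mule1; congr (_ * _)%E.
  exact: probability_setT.
right; exists m, s; split=> [|A mA]; first by rewrite lt_def sn0.
rewrite YA// -(ge0_integral_normal_affine m sn0 (f := fun x => (\1_A x)%:E)).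
- by rewrite integral_indic// setIT.
- by apply/measurable_EFinP; exact: measurable_indic.
- by move=> x; rewrite lee_fin.
Qed.

Lemma Lfun2_integral_sqr Y : measurable_fun setT Y ->
  (\int[P]_w (Y w ^+ 2)%:E < +oo)%E -> Y \in Lfun P 2%:E.
Proof.
move=> mY Yoo; rewrite inE/=; apply/andP; split; rewrite inE//=.
rewrite /finite_norm unlock poweR_lty//=.
under eq_integral do rewrite powR_mulrn// real_normK ?num_real//.
exact: Yoo.
Qed.

(** The shift [c = 0] gives the second moment, and [c = 1] then gives the mean by expanding the
    square. Thus integrals of nonnegative functions are enough to find a signed mean. *)
Lemma moments_of_shifted_sqr Y m s : measurable_fun setT Y ->
  (forall c, \int[P]_w ((c + Y w) ^+ 2)%:E = ((c + m) ^+ 2 + s ^+ 2)%:E)%E ->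
  [/\ Y \in Lfun P 2%:E, 'E_P[Y] = m%:E & 'V_P[Y] = (s ^+ 2)%:E]%E.
Proof.
move=> mY YE.
have EY2 : ('E_P[Y ^+ 2] = (m ^+ 2 + s ^+ 2)%:E)%E.
  rewrite unlock -[m]add0r -YE.
  by apply: eq_integral => w _; rewrite add0r.
have Y2 : Y \in Lfun P 2%:E.
  apply: Lfun2_integral_sqr => //.
  by move: EY2; rewrite unlock => ->; rewrite ltry.
have Pfin : P setT \is a fin_num := fin_num_measure P _ measurableT.
have Y1 := Lfun_subset12 Pfin Y2.
have YY1 : Y ^+ 2 \in Lfun P 1 by exact: Lfun2_mul_Lfun1.
have EY : ('E_P[Y] = m%:E)%E.
  have : ('E_P[((cst 1 \+ 2 \o* Y) \+ Y ^+ 2)%R] = ((1 + m) ^+ 2 + s ^+ 2)%:E)%E.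
    rewrite -YE unlock; apply: eq_integral => w _; congr EFin.
    by rewrite /= fctE; ring.
  rewrite !expectationD ?expectationZl ?expectation_cst ?EY2 ?rpredD ?Lfun_scale ?Lfun_cst//.
  rewrite -(fineK (expectation_fin_num Y1)) -EFinM -!EFinD => -[e].
  by congr EFin; lra.
split=> //; rewrite varianceE// EY2 EY -EFin_expe -EFinB; congr EFin; ring.
Qed.

Lemma affine_normal_moments Y m s : measurable_fun setT Y ->
  affine_normal Y m s ->
  [/\ Y \in Lfun P 2%:E, 'E_P[Y] = m%:E & 'V_P[Y] = (s ^+ 2)%:E]%E.
Proof.
move=> mY YN; apply: moments_of_shifted_sqr => // c.
have msq a : measurable_fun [set: mR] (fun x => ((a + x) ^+ 2)%:E).
  by apply/measurable_EFinP; apply: measurable_funX; exact: measurable_funD.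
rewrite (YN (fun x => ((c + x) ^+ 2)%:E)); [|exact: msq|by move=> x; rewrite lee_fin sqr_ge0].
have [->|s0] := eqVneq s 0.
  under eq_integral do rewrite mul0r addr0.
  rewrite integral_cst// expr0n addr0 -[RHS]mule1; congr (_ * _)%E.
  exact: probability_setT.
(* Factoring out [s] reduces to a standard normal variable shifted by [(c + m) / s]. *)
transitivity ((s ^+ 2)%:E * \int[N01]_z (((c + m) / s + z) ^+ 2)%:E)%E.
  rewrite -ge0_integralZl//; first last.
  - by rewrite lee_fin sqr_ge0.
  - by move=> x _; rewrite lee_fin sqr_ge0.
  apply: eq_integral => z _; rewrite -EFinM; congr EFin.
  by field.
by rewrite integral_sqr_normal -EFinM; congr EFin; field.
Qed.

End normal_law_of_random_variable.

(** * Means of [Phi] and [pos_sqr_mean] under a normal law *)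

Section normal_smoothing.
Context {d : measure_display} {T : measurableType d} {R : realType}.
Local Notation mR := (measurableTypeR R).
Local Notation N01 := (normal_prob (0 : R) 1).
Variable P : probability T R.
Implicit Types (Y : T -> R) (m s : R).

(** [G] is the average of [g] over an independent standard normal [Z], and [Y + Z] has mean [m] and
    variance [1 + s^2]. *)
Lemma affine_normal_smoothing Y m s (g G : R -> R) :
  measurable_fun [set: mR] g -> measurable_fun [set: mR] G ->
  (forall x, 0 <= g x) ->
  (forall x, \int[N01]_z (g (x + z))%:E = (G x)%:E)%E ->
  affine_normal P Y m s ->
  (\int[P]_w (G (Y w))%:E =
   \int[N01]_z (g (m + Num.sqrt (1 + s ^+ 2) * z))%:E)%E.
Proof.
move=> mg mG g0 gG YN.
have G0 x : (0 <= (G x)%:E)%E.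
  by rewrite -gG; apply: integral_ge0 => z _; rewrite lee_fin.
rewrite (YN (fun x => (G x)%:E)) //; last exact/measurable_EFinP.
have mgm : measurable_fun [set: mR] (fun z => (g (m + z))%:E).
  by apply/measurable_EFinP; apply: (measurableT_comp mg); exact: measurable_funD.
transitivity (\int[N01]_x \int[N01]_y (g (m + (s * x + 1 * y)%R))%:E)%E.
  apply: eq_integral => x _; rewrite -gG; apply: eq_integral => y _.
  by rewrite mul1r addrA.
rewrite (ge0_integral_normal_normal s 1 mgm); last by move=> x; rewrite lee_fin.
by rewrite expr1n addrC.
Qed.

Lemma integral_Phi_affine_normal Y m s : affine_normal P Y m s ->
  (\int[P]_w (Phi (Y w))%:E = (Phi (m / Num.sqrt (1 + s ^+ 2)))%:E)%E.
Proof.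
move=> YN; have w0 : 0 < Num.sqrt (1 + s ^+ 2).
  by rewrite sqrtr_gt0 ltr_pwDl ?sqr_ge0.
rewrite (affine_normal_smoothing (measurable_nonneg_indic (R := R))
  (measurable_Phi (R := R)) _ (integral_nonneg_indic (R := R)) YN); last first.
  by move=> x; rewrite /nonneg_indic ler0n.
rewrite -integral_nonneg_indic; apply: eq_integral => z _; congr EFin.
rewrite /nonneg_indic; congr (nat_of_bool _)%:R.
(* Multiplying by the positive standard deviation does not change the sign. *)
rewrite -[RHS](pmulr_rge0 _ w0); congr (_ <= _); field.
by rewrite gt_eqF.
Qed.

Lemma continuous_pos_sqr_mean : continuous (@pos_sqr_mean R).
Proof.
move=> x; apply/differentiable_continuous/derivable1_diffP.
by rewrite /pos_sqr_mean; apply: ex_derive.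
Qed.

Lemma measurable_pos_sqr_mean : measurable_fun [set: mR] (@pos_sqr_mean R).
Proof. by apply: continuous_measurable_fun; exact: continuous_pos_sqr_mean. Qed.

Lemma integral_pos_sqr_mean_affine_normal Y m s : affine_normal P Y m s ->
  (\int[P]_w (pos_sqr_mean (Y w))%:E =
   ((1 + s ^+ 2) * pos_sqr_mean (m / Num.sqrt (1 + s ^+ 2)))%:E)%E.
Proof.
move=> YN; have u0 : 0 < 1 + s ^+ 2 by rewrite ltr_pwDl ?sqr_ge0.
have w0 : 0 < Num.sqrt (1 + s ^+ 2) by rewrite sqrtr_gt0.
rewrite (affine_normal_smoothing (measurable_pos_part_sqr (R := R))
  measurable_pos_sqr_mean _ (integral_pos_part_sqr (R := R)) YN); last first.
  by move=> x; rewrite sqr_ge0.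
rewrite EFinM -integral_pos_part_sqr -ge0_integralZl//; first last.
- by rewrite lee_fin ltW.
- by move=> x _; rewrite lee_fin sqr_ge0.
- apply/measurable_EFinP; apply: (measurableT_comp (measurable_pos_part_sqr (R := R))).
  exact: measurable_funD.
apply: eq_integral => z _; rewrite -EFinM; congr EFin.
set w := Num.sqrt _ in w0 *.
have -> : 1 + s ^+ 2 = w ^+ 2 by rewrite sqr_sqrtr// ltW.
(* The squared positive part is homogeneous of degree two under positive scaling. *)
rewrite /pos_part_sqr -exprMn maxr_pMr ?ltW// mulr0.
by congr (Num.max _ _ ^+ 2); field; rewrite gt_eqF.
Qed.

End normal_smoothing.

(** * Taylor estimates, and the primitive of [gelu] with its Gaussian smoothing *)

Section gelu_primitive.
Context {R : realType}.
Local Notation mR := (measurableTypeR R).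
Implicit Types (x y h u m c : R).

Lemma is_derive_mean_value (f df : R -> R) x y :
  (forall z : R, is_derive z 1 f (df z)) ->
  exists2 c, `|c - x| <= `|y - x| & f y - f x = df c * (y - x).
Proof.
move=> fdf; have cf : continuous f.
  by move=> z; apply/differentiable_continuous/derivable1_diffP; apply: ex_derive.
have [xy|yx] := leP x y.
  have [//|] := @MVT_segment _ f df x y xy (fun z _ => fdf z).
    exact: continuous_subspaceT.
  move=> c; rewrite in_itv/= => /andP[xc cy] fE; exists c => //.
  by rewrite !ger0_norm ?subr_ge0// lerB.
have [|] := @MVT_segment _ f df y x (ltW yx) (fun z _ => fdf z).
  exact: continuous_subspaceT.
move=> c; rewrite in_itv/= => /andP[yc cx] fE; exists c.
  by rewrite !ler0_norm ?subr_le0// ?(ltW yx)// lerN2 lerB.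
by rewrite -opprB fE -mulrN opprB.
Qed.

(** The mean value theorem is used for [f], then for [df] between [x] and the intermediate point,
    which lies within [|h|] of [x]. *)
Lemma taylor1_le (f df ddf : R -> R) K x h :
  (forall z : R, is_derive z 1 f (df z)) ->
  (forall z : R, is_derive z 1 df (ddf z)) ->
  (forall z, `|ddf z| <= K) ->
  `|f (x + h) - f x - df x * h| <= K * h ^+ 2.
Proof.
move=> fdf dfddf ddfK.
have [c cx fE] := is_derive_mean_value x (x + h) fdf.
have [e _ dfE] := is_derive_mean_value x c dfddf.
rewrite addrAC subrr add0r in cx fE.
rewrite fE -mulrBl dfE !normrM -[h ^+ 2]real_normK ?num_real// expr2 mulrA.
by rewrite ler_wpM2r// ler_pM.
Qed.

(** Carathéodory's criterion: the slope from 0, given the value [c] at 0, differs from [c] by at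
    most [K |b|] and so is continuous there. *)
Lemma is_derive_of_quadratic_bound (f : R -> R) c K :
  (forall b, `|f b - f 0 - c * b| <= K * b ^+ 2) -> is_derive (0 : R) (1 : R) f c.
Proof.
move=> fK; apply/is_derive1_caratheodory.
pose g b := if b == 0 then c else (f b - f 0) / b.
exists g; split=> [b||]; rewrite ?subr0.
- by rewrite /g; have [->|b0] := eqVneq b 0; rewrite ?subrr ?mulr0// divfK.
- have K0 : 0 <= K by have := le_trans (normr_ge0 _) (fK 1); rewrite expr1n mulr1.
  have K1 : 0 < K + 1 by rewrite ltr_wpDl.
  have g0 : g 0 = c by rewrite /g eqxx.
  apply/cvgrPdist_le => e e0; apply/nbhs_ballP.
  (* [K] may be zero, hence the division by [K + 1]. *)
  exists (e / (K + 1)); first by rewrite /= divr_gt0.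
  move=> b; rewrite /ball/= sub0r normrN ltr_pdivlMr// => be.
  rewrite g0 /g; have [_|b0] := eqVneq b 0; first by rewrite subrr normr0 ltW.
  apply: (@le_trans _ _ (K * `|b|)).
    rewrite -(ler_pM2r (_ : 0 < `|b|)) ?normr_gt0// distrC -normrM mulrBl divfK//.
    by rewrite -mulrA -expr2 real_normK ?num_real.
  by apply: le_trans (ltW be); rewrite mulrC ler_wpM2l// lerDl.
- by rewrite /g eqxx.
Qed.

Definition gelu_primitive x : R := pos_sqr_mean x / 2 - Phi x.

Lemma is_derive_pos_sqr_mean x :
  is_derive x (1 : R) pos_sqr_mean (2 * (x * Phi x + phi x)).
Proof. by apply: is_derive_eq; rewrite /GRing.scale/=; ring. Qed.

Lemma is_derive_gelu_primitive x : is_derive x (1 : R) gelu_primitive (gelu x).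
Proof.
have := is_derive_pos_sqr_mean x => ?.
by apply: is_derive_eq; rewrite /GRing.scale/= /gelu; field.
Qed.

Lemma is_derive_gelu x : is_derive x (1 : R) gelu (Phi x + x * phi x).
Proof. by apply: is_derive_eq; rewrite /GRing.scale/=; ring. Qed.

Lemma measurable_gelu : measurable_fun [set: mR] (@gelu R).
Proof. by apply: measurable_funM => //; exact: measurable_Phi. Qed.

Lemma norm_gelu_le x : `|gelu x| <= `|x|.
Proof. by rewrite normrM (ger0_norm (Phi_ge0 x)) ler_piMr ?Phi_le1. Qed.

(** The constant bounds the derivative [Phi x + x phi x] of [gelu], term by term. *)
Lemma gelu_primitive_taylor x h :
  `|gelu_primitive (x + h) - gelu_primitive x - gelu x * h| <=
  (1 + normal_peak 1) * h ^+ 2.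
Proof.
apply: (taylor1_le _ _ is_derive_gelu_primitive is_derive_gelu) => z.
rewrite (le_trans (ler_normD _ _))// lerD ?norm_x_phi_le//.
by rewrite ger0_norm ?Phi_ge0 ?Phi_le1.
Qed.

(** The mean of [gelu_primitive] under the normal law of mean [m] and variance [u - 1]. *)
Definition smoothed_gelu_primitive m u : R :=
  u * pos_sqr_mean (m / Num.sqrt u) / 2 - Phi (m / Num.sqrt u).

Lemma is_derive_smoothed_gelu_primitive m u : 0 < u ->
  is_derive u (1 : R) (smoothed_gelu_primitive m)
    ((Phi (m / Num.sqrt u) +
      m / Num.sqrt u ^+ 3 * phi (m / Num.sqrt u)) / 2).
Proof.
move=> u0; have w0 : Num.sqrt u != 0 by rewrite gt_eqF// sqrtr_gt0.
pose q v := m / Num.sqrt v.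
have dq : is_derive u (1 : R) q (- (q u / (2 * u))).
  have dw := is_derive1_sqrt u0.
  have dV := is_deriveV w0 dw.
  apply: is_derive_eq; rewrite /GRing.scale/= /q.
  have uE : u = Num.sqrt u ^+ 2 by rewrite sqr_sqrtr ?ltW.
  set w := Num.sqrt u in w0 uE *; rewrite uE.
  by field.
have dA := is_derive_pos_sqr_mean (q u).
have dAq := is_derive1_comp dA dq.
have dPq := is_derive1_comp (is_derive_Phi (q u)) dq.
have -> : smoothed_gelu_primitive m =
    (fun v => v * (pos_sqr_mean \o q) v / 2 - (Phi \o q) v) by [].
apply: is_derive_eq; rewrite /GRing.scale/= -/(q u).
rewrite /pos_sqr_mean.
have uE : u = Num.sqrt u ^+ 2 by rewrite sqr_sqrtr ?ltW.
(* This makes both sides rational in [u] and [q u], with [Phi (q u)] and [phi (q u)] as atoms. *)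
have -> : m / Num.sqrt u ^+ 3 = q u / u.
  by rewrite /q; set w := Num.sqrt u in w0 uE *; rewrite uE; field.
by field; rewrite gt_eqF.
Qed.

End gelu_primitive.

(** * The covariance as a derivative along [X1 + b (X2 - mu2)] *)

Section gelu_covariance.
Context {d : measure_display} {T : measurableType d} {R : realType}.
Local Notation mR := (measurableTypeR R).
Variable P : probability T R.
Implicit Types (Y : T -> R) (m s : R).

Lemma integrable_affine_normal Y (g : R -> R) (I : R) :
  measurable_fun setT Y -> measurable_fun [set: mR] g -> (forall x, 0 <= g x) ->
  (\int[P]_w (g (Y w))%:E = I%:E)%E -> g \o Y \in Lfun P 1.
Proof.
move=> mY mg g0 gI; apply/Lfun1_integrable/integrableP; split.
  by apply/measurable_EFinP; exact: (measurableT_comp mg).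
rewrite (eq_integral (fun w => (g (Y w))%:E)) ?gI ?ltry// => w _.
by rewrite /= ger0_norm.
Qed.

Lemma pos_sqr_mean_ge0 (x : R) : 0 <= pos_sqr_mean x.
Proof.
rewrite -lee_fin -integral_pos_part_sqr; apply: integral_ge0 => z _.
by rewrite lee_fin sqr_ge0.
Qed.

(** Both terms of [gelu_primitive] are multiples of nonnegative functions with finite known means,
    so linearity of expectation applies. *)
Lemma expectation_gelu_primitive Y m s : measurable_fun setT Y ->
  affine_normal P Y m s ->
  gelu_primitive \o Y \in Lfun P 1 /\
  ('E_P[gelu_primitive \o Y] = (smoothed_gelu_primitive m (1 + s ^+ 2))%:E)%E.
Proof.
move=> mY YN.
have IA := integral_pos_sqr_mean_affine_normal YN.
have IP := integral_Phi_affine_normal YN.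
have LA := integrable_affine_normal mY (measurable_pos_sqr_mean (R := R)) pos_sqr_mean_ge0 IA.
have LP := integrable_affine_normal mY (measurable_Phi (R := R)) (Phi_ge0 (R := R)) IP.
have -> : gelu_primitive \o Y =
    (2^-1 \o* (pos_sqr_mean \o Y)) \- (Phi \o Y) by [].
have L2 : 2^-1 \o* (pos_sqr_mean \o Y) \in Lfun P 1 by rewrite Lfun_scale.
split; first by rewrite rpredB.
rewrite expectationB// expectationZl// unlock IA IP -EFinM -EFinB; congr EFin.
by rewrite /smoothed_gelu_primitive mulrC.
Qed.

Lemma affine_normal_shift Y m s c : affine_normal P Y m s ->
  affine_normal P (fun w => Y w + c) (m + c) s.
Proof.
move=> YN f mf f0; rewrite (YN (fun x => f (x + c))) //.
  by apply: eq_integral => z _; rewrite addrAC.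
by apply: (measurableT_comp mf); exact: measurable_funD.
Qed.

Variables (X1 X2 : {RV P >-> R}) (mu1 mu2 nu11 nu22 nu12 : R).
Hypothesis X12 : normal_pair X1 X2 mu1 mu2 nu11 nu22 nu12.

Lemma measurable_lincomb (a b : R) :
  measurable_fun setT (fun w => a * X1 w + b * X2 w).
Proof. by apply: measurable_funD; apply: measurable_funM. Qed.

(** Joint normality provides parameters [m] and [s] without naming them; the moments identify
    them. *)
Lemma normal_pair_lincomb (a b : R) : exists m s,
  [/\ 0 <= s, affine_normal P (fun w => a * X1 w + b * X2 w) m s,
  (fun w => a * X1 w + b * X2 w) \in Lfun P 2%:E,
  ('E_P[(fun w => a * X1 w + b * X2 w)%R] = m%:E)%E &
  ('V_P[(fun w => a * X1 w + b * X2 w)%R] = (s ^+ 2)%:E)%E].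
Proof.
have mab := measurable_lincomb a b.
have [m [s [s0 Nab]]] := normal_law_affine_normal mab (X12.1 a b).
have [L2 EY VY] := affine_normal_moments mab Nab.
by exists m, s.
Qed.

Lemma normal_pair_Lfun2 :
  (X1 : T -> R) \in Lfun P 2%:E /\ (X2 : T -> R) \in Lfun P 2%:E.
Proof.
split.
- have [m [s [_ _ L _ _]]] := normal_pair_lincomb 1 0.
  move: L; rewrite (_ : (fun w => _) = X1)//.
  by apply/funext => w; rewrite mul1r mul0r addr0.
- have [m [s [_ _ L _ _]]] := normal_pair_lincomb 0 1.
  move: L; rewrite (_ : (fun w => _) = X2)//.
  by apply/funext => w; rewrite mul1r mul0r add0r.
Qed.

(** Centering [X2] keeps the mean at [mu1] for every [b]; bilinearity of the covariance gives the
    variance as a quadratic polynomial in [b]. *)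
Lemma normal_pair_pencil (b : R) : exists2 s,
  affine_normal P (fun w => X1 w + b * (X2 w - mu2)) mu1 s &
  s ^+ 2 = nu11 + 2 * b * nu12 + b ^+ 2 * nu22.
Proof.
have [L1 L2] := normal_pair_Lfun2.
have Pfin : P setT \is a fin_num := fin_num_measure P _ measurableT.
have L11 := Lfun_subset12 Pfin L1; have L21 := Lfun_subset12 Pfin L2.
have [_ [[E1 E2] [V1 V2 C12]]] := X12.
have [m [s [s0 N _ EY VY]]] := normal_pair_lincomb 1 b.
have YE : (fun w => 1 * X1 w + b * X2 w) = (X1 : T -> R) \+ (b \o* X2).
  by apply/funext => w; rewrite /= mul1r mulrC.
have bL2 : b \o* X2 \in Lfun P 2%:E by rewrite Lfun_scale// ler1n.
move: EY; rewrite YE expectationD ?Lfun_scale// expectationZl// E1 E2.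
rewrite -EFinM -EFinD => -[mE].
move: VY; rewrite YE varianceD// varianceZ// covarianceZr ?Lfun2_mul_Lfun1//.
rewrite V1 V2 C12 -!EFinM -!EFinD => -[sE].
exists s; last by rewrite -sE; ring.
have := affine_normal_shift (- (b * mu2)) N.
rewrite -mE addrK; congr (affine_normal _ _ _ _).
by apply/funext => w; rewrite mul1r mulrBr addrA.
Qed.

Lemma expectation_gelu_pencil (b : R) :
  gelu_primitive \o (fun w => X1 w + b * (X2 w - mu2)) \in Lfun P 1 /\
  ('E_P[(gelu_primitive \o (fun w => X1 w + b * (X2 w - mu2)))%R] =
   (smoothed_gelu_primitive mu1
      (1 + (nu11 + 2 * b * nu12 + b ^+ 2 * nu22)))%:E)%E.
Proof.
have [s N <-] := normal_pair_pencil b.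
apply: expectation_gelu_primitive => //.
by apply: measurable_funD => //; apply: measurable_funM => //; exact: measurable_funB.
Qed.

Let V w : R := X2 w - mu2.

Lemma centered_Lfun2 : V \in Lfun P 2%:E.
Proof.
have [_ L2] := normal_pair_Lfun2.
rewrite (_ : V = (X2 : T -> R) \- cst mu2)// rpredB ?lee1n//= => _.
exact: Lfun_cst.
Qed.

Lemma gelu_Lfun2 : gelu \o X1 \in Lfun P 2%:E.
Proof.
have [L1 _] := normal_pair_Lfun2.
have mg : measurable_fun setT (gelu \o X1).
  exact: (measurableT_comp (measurable_gelu (R := R)) (measurable_funPT X1)).
apply: Lfun2_integral_sqr => //.
have /integrableP[_] := Lfun2_integrable_sqr L1.
apply: le_lt_trans; apply: ge0_le_integral => //.
- by move=> w _; rewrite lee_fin sqr_ge0.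
- by apply/measurable_EFinP; exact: measurable_funX.
- by apply: measurableT_comp => //; apply/measurable_EFinP; exact: measurable_funX.
- move=> w _; rewrite /= lee_fin ger0_norm ?sqr_ge0//.
  by rewrite -[_ ^+ 2]real_normK ?num_real// -[X in _ <= X]real_normK ?num_real//
    lerXn2r ?nnegrE// norm_gelu_le.
Qed.

(** As [V] is centered, subtracting the mean of [gelu \o X1] changes nothing. *)
Lemma covariance_gelu_expectation :
  covariance P (gelu \o X1) X2 = 'E_P[(fun w => gelu (X1 w) * V w)%R]%E.
Proof.
have [_ L2] := normal_pair_Lfun2.
have Pfin : P setT \is a fin_num := fin_num_measure P _ measurableT.
have L21 := Lfun_subset12 Pfin L2.
have [_ [[_ E2] _]] := X12.
have VL1 := Lfun_subset12 Pfin centered_Lfun2.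
have EV : ('E_P[V] = 0)%E.
  rewrite (_ : V = (X2 : T -> R) \- cst mu2)// expectationB ?Lfun_cst// E2.
  by rewrite expectation_cst subee.
rewrite unlock E2 /=; set g := fine _.
rewrite (_ : _ * _ = (gelu \o X1) \* V \- (g \o* V)).
  rewrite expectationB ?Lfun_scale ?Lfun2_mul_Lfun1 ?gelu_Lfun2 ?centered_Lfun2//.
  by rewrite expectationZl// EV mule0 sube0.
by apply/funext => w; rewrite /= /V; rewrite !fctE/= mulrBl (mulrC g).
Qed.

(** Taylor's estimate with increment [b V], integrated, bounds the remainder of the mean by a
    constant times [b^2]. *)
Lemma covariance_gelu_derivative : exists2 c : R,
  ('E_P[(fun w => gelu (X1 w) * V w)%R] = c%:E)%E &
  is_derive (0 : R) (1 : R) (fun b => smoothed_gelu_primitive mu1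
      (1 + (nu11 + 2 * b * nu12 + b ^+ 2 * nu22))) c.
Proof.
have gVL1 := Lfun2_mul_Lfun1 gelu_Lfun2 centered_Lfun2.
have Efin := expectation_fin_num gVL1.
exists (fine 'E_P[(fun w => gelu (X1 w) * V w)%R])%E; first by rewrite fineK.
set c := fine _.
have cE : ('E_P[((gelu \o X1) \* V)%R] = c%:E)%E by rewrite fineK.
(* [K] is the Taylor constant of [gelu_primitive] and [I] the second moment of [V]; their product
   bounds the integrated remainder. *)
pose K : R := 1 + normal_peak 1.
pose I := fine 'E_P[(V \* V)%R]%E.
have VVL1 := Lfun2_mul_Lfun1 centered_Lfun2 centered_Lfun2.
have IE : ('E_P[(V \* V)%R] = I%:E)%E by rewrite fineK// expectation_fin_num.
apply: (@is_derive_of_quadratic_bound _ _ _ (K * I)) => b.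
have [Lb Eb] := expectation_gelu_pencil b.
have [L0 E0] := expectation_gelu_pencil 0.
set hb := smoothed_gelu_primitive _ _; set h0 := smoothed_gelu_primitive _ _.
rewrite -/hb in Eb; rewrite -/h0 in E0.
set Fb := gelu_primitive \o _ in Lb Eb.
set F0 := gelu_primitive \o _ in L0 E0.
pose D := (Fb \- F0) \- (b \o* ((gelu \o X1) \* V)).
have LF : Fb \- F0 \in Lfun P 1 by rewrite rpredB.
have LG : b \o* ((gelu \o X1) \* V) \in Lfun P 1 by rewrite Lfun_scale.
have LD : D \in Lfun P 1 by rewrite rpredB.
have ED : ('E_P[D] = (hb - h0 - c * b)%:E)%E.
  rewrite (expectationB LF LG) (expectationB Lb L0) (expectationZl b gVL1).
  by rewrite Eb E0 cE -EFinM -!EFinB mulrC.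
rewrite -lee_fin -[X in (X <= _)%E]abse_EFin -ED.
have -> : ((K * I * b ^+ 2)%:E = 'E_P[((K * b ^+ 2) \o* (V \* V))%R])%E.
  by rewrite expectationZl// IE -EFinM mulrAC.
have mV : measurable_fun setT V by exact: measurable_funB.
(* Move the absolute value inside the expectation, then apply the Taylor bound pointwise. *)
rewrite unlock; apply: le_trans (le_abse_integral _ _ _) _ => //.
  by have /Lfun1_integrable/integrableP[] := LD.
apply: ge0_le_integral => //.
- by apply: measurableT_comp => //; have /Lfun1_integrable/integrableP[] := LD.
- by apply/measurable_EFinP; apply: measurable_funM => //; exact: measurable_funM.
move=> w _; rewrite /= lee_fin.
have := gelu_primitive_taylor (X1 w) (b * V w).
congr (_ <= _).
  rewrite /D /Fb /F0 /= mul0r addr0 -/(V w); congr `|_ - _|; ring.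
by rewrite /K; ring.
Qed.

End gelu_covariance.

(** * Construction of normal pairs with a prescribed covariance matrix *)

Section normal_pair_existence.
Context {R : realType}.
Local Notation mR := (measurableTypeR R).
Local Notation N01 := (normal_prob (0 : R) 1).
Implicit Types a b c k p q x y nu mu : R.

Lemma psd_sym_mx2 nu11 nu12 nu22 : psd (sym_mx2 nu11 nu12 nu22) ->
  forall x y, 0 <= nu11 * x ^+ 2 + 2 * nu12 * (x * y) + nu22 * y ^+ 2.
Proof.
case=> _ h x y.
pose v := @col_mx R 1 1 1 x%:M y%:M.
pose A := @block_mx R 1 1 1 1 nu11%:M nu12%:M nu12%:M nu22%:M.
have : 0 <= (v^T *m A *m v) 0 0 by exact: h v.
rewrite /v /A tr_col_mx !tr_scalar_mx mul_row_block mul_row_col -!scalar_mxM -!raddfD/=.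
rewrite -!scalar_mxM -raddfD/= mxE eqxx mulr1n.
by congr (_ <= _); ring.
Qed.

(** The triangular factor has rows [(a, 0)] and [(b, c)], with [c^2] the Schur complement when
    [nu11] is nonzero. *)
Lemma psd_cholesky nu11 nu12 nu22 : psd (sym_mx2 nu11 nu12 nu22) ->
  exists a b c, [/\ a ^+ 2 = nu11, a * b = nu12 & b ^+ 2 + c ^+ 2 = nu22].
Proof.
move=> /psd_sym_mx2 h.
have nu11_ge0 : 0 <= nu11 by have := h 1 0; rewrite !expr2; lra.
have nu22_ge0 : 0 <= nu22 by have := h 0 1; rewrite !expr2; lra.
have [nu11_0|nu11_n0] := eqVneq nu11 0.
  have nu12_0 : nu12 = 0.
    apply/eqP; apply: contraT => n0.
    (* With [nu11 = 0] and [y = 1] the form is affine in [x]; this [x] is where it would equal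
       -1. *)
    have := h (- (nu22 + 1) / (2 * nu12)) 1.
    rewrite nu11_0 (_ : _ + _ = -1); first lra.
    by field.
  exists 0, 0, (Num.sqrt nu22).
  by rewrite nu11_0 nu12_0 sqr_sqrtr// expr0n mul0r add0r.
have nu11_gt0 : 0 < nu11 by rewrite lt_def nu11_n0.
have det_ge0 : 0 <= nu22 - nu12 ^+ 2 / nu11.
  (* At this vector the form equals [nu11] times the determinant. *)
  have := h (- nu12) nu11.
  rewrite (_ : _ + _ = nu11 ^+ 2 * (nu22 - nu12 ^+ 2 / nu11)); last by field.
  by rewrite pmulr_rge0// exprn_gt0.
have a0 : Num.sqrt nu11 != 0 by rewrite gt_eqF// sqrtr_gt0.
exists (Num.sqrt nu11), (nu12 / Num.sqrt nu11), (Num.sqrt (nu22 - nu12 ^+ 2 / nu11)).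
rewrite expr_div_n !sqr_sqrtr//; split=> //; first by field.
by rewrite addrC subrK.
Qed.

Let P2 : probability (mR * mR)%type R := (N01 \x N01)%E.

Definition plane_affine k p q (z : mR * mR) : R := k + (p * z.1 + q * z.2).

Lemma measurable_plane_affine k p q : measurable_fun setT (plane_affine k p q).
Proof.
by apply: measurable_funD => //; apply: measurable_funD; exact: measurable_funM.
Qed.

HB.instance Definition _ k p q := isMeasurableFun.Build _ _ _ _
  (plane_affine k p q) (measurable_plane_affine k p q).

Lemma plane_affine_normal k p q :
  affine_normal P2 (plane_affine k p q) k (Num.sqrt (p ^+ 2 + q ^+ 2)).
Proof.
move=> f mf f0.
have mfk : measurable_fun [set: mR] (fun x => f (k + x)).
  by apply: (measurableT_comp mf); exact: measurable_funD.
rewrite -(ge0_integral_normal_normal p q mfk) => [|x]; last exact: f0.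
rewrite (fubini_tonelli1 (fun z => f (plane_affine k p q z)))//.
exact: (measurableT_comp mf (measurable_plane_affine k p q)).
Qed.

Lemma plane_affine_moments k p q :
  [/\ plane_affine k p q \in Lfun P2 2%:E, 'E_P2[plane_affine k p q] = k%:E &
      'V_P2[plane_affine k p q] = (p ^+ 2 + q ^+ 2)%:E]%E.
Proof.
have [L E V] := affine_normal_moments (measurable_plane_affine k p q)
  (plane_affine_normal k p q).
by rewrite sqr_sqrtr ?addr_ge0 ?sqr_ge0 in V.
Qed.

Lemma plane_affineD k p q k' p' q' :
  plane_affine k p q \+ plane_affine k' p' q' =
  plane_affine (k + k') (p + p') (q + q').
Proof. by apply/funext => z; rewrite /plane_affine/=; ring. Qed.

(** A linear combination of affine functions of the plane is again one, hence normal by the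
    convolution formula. *)
Lemma plane_normal_pair mu1 mu2 a b c :
  @normal_pair R _ _ P2 (plane_affine mu1 a 0 : {mfun _ >-> _})
    (plane_affine mu2 b c : {mfun _ >-> _})
    mu1 mu2 (a ^+ 2) (b ^+ 2 + c ^+ 2) (a * b).
Proof.
have [L1 E1 V1] := plane_affine_moments mu1 a 0.
have [L2 E2 V2] := plane_affine_moments mu2 b c.
split.
  move=> x y.
  rewrite (_ : (fun w => _) =
    plane_affine (x * mu1 + y * mu2) (x * a + y * b) (y * c)); last first.
    by apply/funext => z; rewrite /= /plane_affine; ring.
  apply: (affine_normal_law (sqrtr_ge0 _)); last exact: plane_affine_normal.
  exact: measurable_plane_affine.
split; first by split.
split=> //; first by rewrite V1 expr0n addr0.
have Pfin : P2 setT \is a fin_num := fin_num_measure P2 _ measurableT.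
have Cfin := covariance_fin_num (Lfun_subset12 Pfin L1) (Lfun_subset12 Pfin L2)
  (Lfun2_mul_Lfun1 L1 L2).
(* Polarization: the covariance is read off the variance of the sum, itself an affine function with
   known moments. *)
have := varianceD L1 L2; rewrite plane_affineD.
have [_ _ ->] := plane_affine_moments (mu1 + mu2) (a + b) (0 + c).
rewrite V1 V2 -(fineK Cfin) -EFinM -!EFinD => -[e].
by congr EFin; move: e; rewrite !expr2; lra.
Qed.

End normal_pair_existence.

(** * Existence of the pair and evaluation of the derivative at 0 *)

Unset Implicit Arguments.
Set Strict Implicit.

Theorem lemmaD3 (R : realType) (mu1 nu11 nu22 nu12 : R)
    (hpsd : psd (sym_mx2 nu11 nu12 nu22)) :
  is_L gelu mu1 nu11 nu22 nu12
    (nu12 * (mu1 / (1 + nu11) `^ (3 / 2)) * phi (mu1 / Num.sqrt (1 + nu11))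
     + nu12 * Phi (mu1 / Num.sqrt (1 + nu11))).
Proof.
have nu11_ge0 : 0 <= nu11 by have := psd_sym_mx2 hpsd 1 0; rewrite !expr2; lra.
have u0 : 0 < 1 + nu11 by rewrite ltr_pwDl.
move=> mu2; split.
  have [a [b [c [<- <- <-]]]] := psd_cholesky hpsd.
  by do 5 eexists; exact: plane_normal_pair.
move=> d T P X1 X2 X12.
rewrite (covariance_gelu_expectation X12).
have [c -> dc] := covariance_gelu_derivative X12; congr EFin.
set W := smoothed_gelu_primitive mu1 in dc.
(* One plus the variance along the pencil. Its slope [2 nu12] at 0 absorbs the factor one half in
   the derivative of [W]. *)
pose p b : R := 1 + (nu11 + 2 * b * nu12 + b ^+ 2 * nu22).
have p0 : p 0 = 1 + nu11 by rewrite /p; ring.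
have dp : is_derive (0 : R) (1 : R) p (2 * nu12).
  by apply: is_derive_eq; rewrite /GRing.scale/=; ring.
have dW := is_derive_smoothed_gelu_primitive mu1 u0.
rewrite -p0 in dW.
have dWp := is_derive1_comp dW dp.
(* Uniqueness of the derivative of [W \o p] at 0 equates the covariance with the chain-rule
   value. *)
rewrite -[LHS](@derive_val _ _ _ _ _ _ _ dc).
rewrite [LHS](@derive_val _ _ _ _ _ _ _ dWp) p0.
have -> : (1 + nu11) `^ (3 / 2) = Num.sqrt (1 + nu11) ^+ 3.
  by rewrite mulrC powRrM powR12_sqrt ?ltW// powR_mulrn ?sqrtr_ge0.
by field; rewrite gt_eqF// sqrtr_gt0.
Qed.
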